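(* Let $G$ be a finite connected simple graph with $n$ vertices and $m$ edges, and let $k\ge 1$ be an integer. Then \[M_2(R_k(G))=2k(k+1)M_1(G)+(k+1)^2M_2(G).\]
   Context: For a graph $H$ and vertex $v$, $d_H(v)$ denotes the degree of $v$ in $H$. Define $M_1(H)=\sum_{v\in V(H)} d_H(v)^2$ and $M_2(H)=\sum_{uv\in E(H)} d_H(u)d_H(v)$. The $k$-th semi total point graph $R_k(G)$ is obtained from $G$ by adding, for each edge $uv$ of $G$, $k$ new vertices (distinct for distinct edges) and joining each of them to both $u$ and $v$ (the edges of $G$ are kept). *)

(* Defs.v *)
From HB Require Import structures.
From mathcomp Require Import all_boot.

Set Implicit Arguments.
Unset Strict Implicit.
Unset Printing Implicit Defensive.

Record sgraph := SGraph {
  vertex :> finType;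
  adj : rel vertex;
  adj_sym : symmetric adj;
  adj_irrefl : irreflexive adj
}.

(* An edge is the unordered pair of its ends. *)
Definition edges (G : sgraph) : {set {set G}} :=
  [set [set p.1; p.2] | p in [pred p : G * G | adj p.1 p.2]].

(* The graph without vertices also satisfies this predicate. *)
Definition connected_graph (G : sgraph) : Prop :=
  forall x y : G, connect (@adj G) x y.

Definition degree (G : sgraph) (v : G) : nat := #|[set u | adj v u]|.

Definition M1 (G : sgraph) : nat := \sum_(v : G) degree v ^ 2.

(* An edge A = [set u; v] has u != v, so the inner product has exactly the two
   factors degree u and degree v. *)
Definition M2 (G : sgraph) : nat :=
  \sum_(A in edges G) \prod_(v in A) degree v.

Section SemiTotalPoint.
Variables (G : sgraph) (k : nat).

(* inr (A, i) is the i-th of the k new vertices attached to the edge A. *)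
Definition semi_total_point_vertex : finType :=
  (G + {A : {set G} | A \in edges G} * 'I_k)%type.

Definition semi_total_point_adj : rel semi_total_point_vertex :=
  fun a b =>
    match a, b with
    | inl u, inl v => adj u v
    | inl u, inr (A, _) => u \in val A
    | inr (A, _), inl v => v \in val A
    | inr _, inr _ => false
    end.

Lemma semi_total_point_adj_sym : symmetric semi_total_point_adj.
Proof. by move=> [u|[A i]] [v|[B j]] //=; apply: adj_sym. Qed.

Lemma semi_total_point_adj_irrefl : irreflexive semi_total_point_adj.
Proof. by move=> [u|[A i]] //=; apply: adj_irrefl. Qed.

Definition semi_total_point : sgraph :=
  SGraph semi_total_point_adj_sym semi_total_point_adj_irrefl.

End SemiTotalPoint.

(* Main.v *)
(** Counting each edge from both of its ends turns [2 * M2 H] into a sum over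
    ordered pairs of adjacent vertices. In the semi total point graph an old
    vertex [u] has degree [(k + 1) * degree u], since each edge at [u] brings [k]
    new neighbours, and a new vertex has degree 2. Old-old pairs contribute
    [(k + 1) ^ 2 * (2 * M2 G)]; old-new and new-old pairs each contribute the sum
    over [u] of [k * degree u] terms equal to [2 * (k + 1) * degree u]. *)

Require Import Defs.
From HB Require Import structures.
From mathcomp Require Import all_boot.
From mathcomp Require Import zify.

Lemma adj_neq (G : sgraph) (u v : G) : adj u v -> u != v.
Proof. by case: eqP => // ->; rewrite adj_irrefl. Qed.

Lemma edgesP (G : sgraph) (A : {set G}) :
  reflect (exists u v : G, adj u v /\ A = [set u; v]) (A \in edges G).
Proof.
apply: (iffP imsetP) => [[[u v] /= uv ->]|[u [v [uv ->]]]].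
  by exists u, v.
by exists (u, v).
Qed.

Lemma card_edge (G : sgraph) (A : {set G}) : A \in edges G -> #|A| = 2.
Proof. by move=> /edgesP[u [v [/adj_neq uv ->]]]; rewrite cards2 uv. Qed.

(** The map sending [v] to [[set u; v]] is a bijection from the neighbours of [u] onto the edges
    containing [u]. *)
Lemma sum_edges_at (G : sgraph) (u : G) (F : {set G} -> nat) :
  \sum_(A in edges G | u \in A) F A = \sum_(v | adj u v) F [set u; v].
Proof.
rewrite -(big_imset (h := fun v : G => [set u; v]) F) => [|v w /= uv uw vw].
  apply: eq_bigl => A; apply/andP/imsetP => [[/edgesP[x [y [xy ->]]]]|[v uv ->]].
    case/set2P=> ->; first by exists y.
    by exists x; [change (adj y x); rewrite adj_sym | rewrite setUC].
  by split; [apply/edgesP; exists u, v | rewrite set21].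
(* Injectivity: [v] lies in [[set u; w]], and [v = u] would make [u] adjacent to itself. *)
have := set22 u v; rewrite vw => /set2P[vu|//].
by move: (adj_neq _ _ _ uv); rewrite vu eqxx.
Qed.

Lemma sum_adj_const (G : sgraph) (u : G) (c : nat) :
  \sum_(v | adj u v) c = degree u * c.
Proof. by rewrite -sum_nat_const; apply: eq_bigl => v; rewrite inE. Qed.

Lemma degreeE (G : sgraph) (u : G) : degree u = \sum_(v | adj u v) 1.
Proof. by rewrite sum_adj_const muln1. Qed.

Lemma double_M2 (G : sgraph) :
  2 * M2 G = \sum_(u : G) \sum_(v | adj u v) degree u * degree v.
Proof.
transitivity (\sum_(A in edges G) \sum_(u in A) \prod_(v in A) degree v).
  rewrite big_distrr /=; apply: eq_bigr => A /card_edge cA.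
  by rewrite sum_nat_const cA.
rewrite (exchange_big_dep predT) //=; apply: eq_bigr => u _.
rewrite sum_edges_at; apply: eq_bigr => v /adj_neq uv.
by rewrite big_setU1 ?big_set1 ?inE.
Qed.

Section SemiTotalPointDegrees.
Variables (G : sgraph) (k : nat).
Local Notation R := (semi_total_point G k).
Local Notation new := ({A : {set G} | A \in edges G} * 'I_k)%type.

(** Neither [P] nor [F] sees the index in ['I_k], so summing over it only contributes a factor
    [k]. *)
Lemma sum_new (P : pred {set G}) (F : {set G} -> nat) :
  \sum_(x : new | P (val x.1)) F (val x.1) = k * \sum_(A in edges G | P A) F A.
Proof.
rewrite (eq_bigl (fun x : new => P (val x.1) && true)) => [|x]; last by rewrite andbT.
rewrite -(pair_big (fun A : {A | A \in edges G} => P (val A)) xpredT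
  (fun A _ => F (val A))) /=.
under eq_bigr do rewrite sum_nat_const card_ord.
rewrite -big_distrr /=; congr (_ * _).
by rewrite big_sub_cond.
Qed.

Lemma sum_adj_old (u : G) (F : R -> nat) :
  \sum_(b : R | adj (inl u : R) b) F b =
  \sum_(v | adj u v) F (inl v) + \sum_(x : new | u \in val x.1) F (inr x).
Proof.
by rewrite big_sumType /=; congr (_ + _); apply: eq_bigl => -[].
Qed.

Lemma sum_adj_new (x : new) (F : R -> nat) :
  \sum_(b : R | adj (inr x : R) b) F b = \sum_(v in val x.1) F (inl v).
Proof.
by case: x => A i; rewrite big_sumType /= [X in _ + X]big_pred0 ?addn0 // => -[].
Qed.

Lemma degree_old (u : G) : degree (inl u : R) = (k + 1) * degree u.
Proof.
rewrite !degreeE sum_adj_old (sum_new (fun A => u \in A) (fun=> 1)).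
by rewrite sum_edges_at mulnDl mul1n addnC.
Qed.

Lemma degree_new (x : new) : degree (inr x : R) = 2.
Proof. by rewrite degreeE sum_adj_new sum1_card (card_edge _ _ (valP x.1)). Qed.

Lemma sum_old_new :
  \sum_(u : G) \sum_(x : new | u \in val x.1) (k + 1) * degree u * 2 =
  2 * k * (k + 1) * M1 G.
Proof.
rewrite /M1 big_distrr; apply: eq_bigr => u _ /=.
rewrite (sum_new (fun A => u \in A) (fun=> (k + 1) * degree u * 2)).
rewrite sum_edges_at sum_adj_const -mulnn; lia.
Qed.

End SemiTotalPointDegrees.

Theorem theorem2p9 (G : sgraph) (n m k : nat)
  (hn : #|G| = n) (hm : #|edges G| = m)
  (hconn : connected_graph G) (hk : 1 <= k) :
  M2 (semi_total_point G k) = 2 * k * (k + 1) * M1 G + (k + 1) ^ 2 * M2 G.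
Proof.
(* Doubling both sides lets [double_M2] apply; the outer sum then splits into old and new first
   vertices. *)
apply/eqP; rewrite -(eqn_pmul2l (isT : 0 < 2)) double_M2 big_sumType /=.
apply/eqP.
under eq_bigr => u _.
  rewrite sum_adj_old degree_old.
  under eq_bigr do rewrite degree_old mulnACA mulnn.
  under [X in _ + X]eq_bigr do rewrite degree_new.
  rewrite -big_distrr; over.
under [X in _ + X]eq_bigr => x _.
  rewrite sum_adj_new degree_new.
  under eq_bigr do rewrite degree_old mulnC.
  over.
(* Summing the new-old pairs over the old vertex first gives the same double sum as the old-new
   pairs, so [sum_old_new] evaluates both. *)
rewrite [X in _ + X](exchange_big_dep predT) //=.
rewrite big_split -big_distrr /= -double_M2 sum_old_new.
lia.
Qed.
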